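(* Let $C\in\mathbb{Z}^{\ell\times n}$ and let $A\in\mathbb{Z}^{m\times n}$, with $\operatorname{rank}(A)=n$, be any submatrix of the matrix $$\begin{pmatrix} \mathbb{I}^n\\ -\mathbb{I}^n\\ C\\ -C\end{pmatrix},$$ where $\mathbb{I}^n$ is the $n\times n$ identity matrix. If $B,T\subseteq\mathbb{Z}^\ell$ are such that the set of distinct columns of $C$ is contained in $B+(T\cup\{0\})$, then $i(A,b)\le|B|+|T|$ for all $b\in\mathbb{Z}^m$.
   Context: For $K^1,K^2\subseteq\mathbb{R}^\ell$, $K^1+K^2:=\{x+y: x\in K^1, y\in K^2\}$. For $A\in\mathbb{Z}^{m\times n}$ with $\operatorname{rank}(A)=n$ and $b\in\mathbb{Z}^m$, let $P(A,b):=\{x\in\mathbb{R}^n : Ax\le b\}$ and $\mathrm{IP}(A,b):=\operatorname{conv}\{x\in P(A,b): x\in\mathbb{Z}^n\}$. For $W\in\mathbb{Z}^{k\times n}$ let $W\text{-}\mathrm{MIP}(A,b):=\operatorname{conv}\{x\in P(A,b): Wx\in\mathbb{Z}^k\}$ (for $k=0$ this equals $P(A,b)$). The integrality number is $$i(A,b):=\min\{k\in\mathbb{Z}_{\ge 0}: \exists\, W\in\mathbb{Z}^{k\times n}\text{ with } W\text{-}\mathrm{MIP}(A,b)=\mathrm{IP}(A,b)\}.$$ Since $A$ has $n$ columns, it consists of a selection of rows of the displayed matrix. *)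

(* Defs.v *)
From mathcomp Require Import all_boot all_order all_algebra.
From mathcomp Require Import all_classical all_reals all_analysis.

Set Implicit Arguments.
Unset Strict Implicit.
Unset Printing Implicit Defensive.

Import Order.TTheory GRing.Theory Num.Theory.

Local Open Scope classical_set_scope.
Local Open Scope ring_scope.

Definition convex_hull (R : numDomainType) (M : lmodType R) (X : set M) :
  set M := smallest (@convex_set R M) X.

Definition int_mx (R : pzRingType) (m n : nat) (A : 'M[int]_(m, n)) :
  'M[R]_(m, n) := map_mx intr A.

Arguments int_mx R {m n} A.

Definition polyhedron (R : realType) (m n : nat) (A : 'M[int]_(m, n))
    (b : 'cV[int]_m) : set 'cV[R]_n :=
  [set x | forall i, (int_mx R A *m x) i 0 <= int_mx R b i 0].

Arguments polyhedron R {m n} A b.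

Definition integer_hull (R : realType) (m n : nat) (A : 'M[int]_(m, n))
    (b : 'cV[int]_m) : set 'cV[R]_n :=
  convex_hull [set x | polyhedron R A b x /\ x \is a mxOver Num.int].

Arguments integer_hull R {m n} A b.

Definition mixed_integer_hull (R : realType) (k m n : nat)
    (W : 'M[int]_(k, n)) (A : 'M[int]_(m, n)) (b : 'cV[int]_m) :
    set 'cV[R]_n :=
  convex_hull
    [set x | polyhedron R A b x /\ int_mx R W *m x \is a mxOver Num.int].

Arguments mixed_integer_hull R {k m n} W A b.

Definition sufficient_integrality (R : realType) (m n : nat)
    (A : 'M[int]_(m, n)) (b : 'cV[int]_m) (k : nat) : Prop :=
  exists W : 'M[int]_(k, n), mixed_integer_hull R W A b = integer_hull R A b.

Arguments sufficient_integrality R {m n} A b k.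

(* k = n always works, with W the identity matrix; hence the minimum below is
   taken over a nonempty set. *)
Lemma ex_sufficient_integrality (R : realType) (m n : nat)
    (A : 'M[int]_(m, n)) (b : 'cV[int]_m) :
  exists k, `[< sufficient_integrality R A b k >].
Proof.
exists n; apply/asboolP; exists 1%:M.
by rewrite /mixed_integer_hull /int_mx map_mx1; under eq_set do rewrite mul1mx.
Qed.

Definition integrality_number (R : realType) (m n : nat)
    (A : 'M[int]_(m, n)) (b : 'cV[int]_m) : nat :=
  ex_minn (ex_sufficient_integrality R A b).

Arguments integrality_number R {m n} A b.

(* Rows and columns may be deleted, but neither repeated nor reordered; when
   n = q, g is forced to be the identity. *)
Definition submatrix (T : Type) (m n p q : nat) (A : 'M[T]_(m, n))
    (M : 'M[T]_(p, q)) : Prop :=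
  exists (f : 'I_m -> 'I_p) (g : 'I_n -> 'I_q),
    [/\ {homo f : i j / (i < j)%N}, {homo g : i j / (i < j)%N}
      & A = mxsub f g M].

Definition signed_stack (l n : nat) (C : 'M[int]_(l, n)) :
    'M[int]_((n + n) + (l + l), n) :=
  col_mx (col_mx 1%:M (- 1%:M)) (col_mx C (- C)).

Definition minkowski_sum (V : nmodType) (X Y : set V) : set V :=
  [set x + y | x in X & y in Y].

(* Main.v *)
Require Import Defs.
From mathcomp Require Import all_boot all_order all_algebra finmap.
From mathcomp Require Import all_classical all_reals all_analysis.
From mathcomp Require Import ring lra.

(** Write every column of C as beta + tau with beta in B and tau in T or
    tau = 0, and let W have one row per element of B and one per element of T,
    namely the indicator vector of the columns that use this element. Then:

    - C x is a linear function of the sums of the coordinates of x over the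
      classes given by beta and tau, so C x depends only on W x, and the rows
      of C and - C in the system A x <= b cannot tell apart two points with
      the same image under W ([class_sums_determine_mulmx]). The remaining
      rows are integral bounds on single coordinates, which survive when every
      coordinate of x moves between its floor and its ceiling
      ([tightens_polyhedron]).
    - View coordinate j as an edge joining its beta-class to its tau-class.
      Together with a row for tau = 0, whose value is integral as soon as the
      other ones are ([class_indicators_int]), W is the incidence matrix of a
      bipartite graph. Hence a point x with W x
      integral is a convex combination of integral points y with W y = W x that
      lie between floor and ceiling of x ([convex_rounding]).

    Together these say that the mixed-integer points lie in the integer hull,
    so that |B| + |T| rows suffice.

    The second item could be read off the total unimodularity of W, but a count
    is enough. If a class sum is an integer, the class does not contain exactly
    one fractional coordinate. So if s > 0 coordinates of x are fractional,
    they meet at most s/2 beta-classes and at most s/2 tau-classes. The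
    corresponding s columns of W live in at most s rows, and these rows are
    dependent, because the beta-rows and the tau-rows have the same sum.
    Therefore W d = 0 for some nonzero d supported on the fractional
    coordinates ([bipartite_kernel]). Moving from x along d and along - d until
    a coordinate becomes integral exhibits x as a convex combination of two
    points with fewer fractional coordinates, and induction applies. *)

Set Implicit Arguments.
Unset Strict Implicit.
Unset Printing Implicit Defensive.

Import Order.TTheory GRing.Theory Num.Theory.

Local Open Scope classical_set_scope.
Local Open Scope ring_scope.

(** * Kernel vectors of bipartite incidence matrices *)

(** The edge-vertex incidence matrix of the edges in S, on one side of the
    bipartite graph. Only the classes that meet S get a column: the rank
    bound below counts these columns. *)
Definition class_incidence (F : pzRingType) (E I : finType) (h : E -> I)
    (S : {set E}) : 'M[F]_(#|S|, #|h @: S|) :=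
  \matrix_(s, i) (h (enum_val s) == enum_val i)%:R.

Arguments class_incidence F {E I} h S.

(** Each edge has exactly one endpoint on a given side. Both sides of a
    bipartite graph thus have the same column sum, which is the linear
    dependency that makes [bipartite_kernel] work. *)
Lemma class_incidence_const1 (F : pzRingType) (E I : finType) (h : E -> I)
    (S : {set E}) :
  class_incidence F h S *m const_mx 1 = const_mx 1 :> 'cV_#|S|.
Proof.
apply/matrixP => s k; rewrite !mxE.
under eq_bigr => i _ do rewrite !mxE mulr1.
have hsS : h (enum_val s) \in h @: S by apply: imset_f; apply: enum_valP.
rewrite (bigD1 (enum_rank_in hsS (h (enum_val s)))) //=.
rewrite enum_rankK_in // eqxx big1 ?addr0 // => i ni.
case: eqP => // e; case/eqP: ni; apply: enum_val_inj.
by rewrite enum_rankK_in.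
Qed.

(** Extending a kernel vector by zero outside S keeps all class sums zero,
    including those of the classes that S does not meet. *)
Lemma class_sum_extend0 (F : pzRingType) (n : nat) (I : finType)
    (h : 'I_n -> I) (S : {set 'I_n}) (u : 'rV[F]_#|S|) :
  u *m class_incidence F h S = 0 ->
  forall i, \sum_(j | h j == i) \sum_(s | enum_val s == j) u 0 s = 0.
Proof.
move=> u0 i.
rewrite (exchange_big_dep xpredT) //=.
have -> : \sum_s \sum_(j | (h j == i) && (enum_val s == j)) u 0 s
    = \sum_s u 0 s * (h (enum_val s) == i)%:R.
  apply: eq_bigr => s _.
  have [e|ne] := eqVneq (h (enum_val s)) i.
    rewrite (big_pred1 (enum_val s)) ?mulr1 // => j /=.
    by case: (eqVneq (enum_val s) j) => [<-|];
      rewrite ?e ?eqxx ?andbF // eq_sym => /negbTE ->.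
  rewrite mulr0 big_pred0 // => j.
  by case: (eqVneq (enum_val s) j) => [<-|]; rewrite ?andbF // andbT (negbTE ne).
have [iS|iS] := boolP (i \in h @: S).
  have := congr1 (fun M : 'rV_ _ => M 0 (enum_rank_in iS i)) u0.
  rewrite !mxE => uE; rewrite -[RHS]uE.
  by apply: eq_bigr => s _; rewrite mxE enum_rankK_in.
rewrite big1 // => s _; case: eqP => [e|_]; last by rewrite mulr0.
by case/negP: iS; rewrite -e imset_f // enum_valP.
Qed.

Lemma double_card_imset_le (E I : finType) (h : E -> I) (S : {set E}) :
  (forall j, j \in S -> exists k, [/\ k \in S, k != j & h k = h j]) ->
  (#|h @: S|.*2 <= #|S|)%N.
Proof.
move=> hS; rewrite -muln2 -sum_nat_const -[leqRHS]sum1_card.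
rewrite (partition_big_imset h) /=; apply: leq_sum => i /imsetP[j jS ->].
have [k [kS kj hk]] := hS j jS.
by rewrite (bigD1 j) /= ?jS ?eqxx // (bigD1 k) /= ?kS ?hk ?eqxx.
Qed.

(** Were the edges of S independent rows, the incidence matrix would need at
    least #|S| columns; by [double_card_imset_le] it has no more than that, so
    it would be invertible. But 1 on the f-classes and - 1 on the g-classes is
    a nonzero vector that it kills. *)
Lemma bipartite_kernel (F : fieldType) (n : nat) (I J : finType)
    (f : 'I_n -> I) (g : 'I_n -> J) (S : {set 'I_n}) :
  S != finset.set0 ->
  (forall j, j \in S -> exists k, [/\ k \in S, k != j & f k = f j]) ->
  (forall j, j \in S -> exists k, [/\ k \in S, k != j & g k = g j]) ->
  exists d : 'cV[F]_n,
    [/\ d != 0, forall j, j \notin S -> d j 0 = 0,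
        forall i, \sum_(j | f j == i) d j 0 = 0
      & forall i, \sum_(j | g j == i) d j 0 = 0].
Proof.
move=> S0 fS gS.
pose M := row_mx (class_incidence F f S) (class_incidence F g S).
have nfree : ~~ row_free M.
  apply/negP => Mfree.
  have Mfull : row_full M.
    rewrite /row_full eqn_leq rank_leq_col (eqP Mfree).
    rewrite -leq_double doubleD -[leqRHS]addnn.
    by rewrite leq_add ?double_card_imset_le.
  pose v : 'cV[F]_(#|f @: S| + #|g @: S|) := col_mx (const_mx 1) (- const_mx 1).
  have : M *m v = M *m 0.
    by rewrite mul_row_col mulmxN !class_incidence_const1 subrr mulmx0.
  move/(row_full_inj Mfull)/colP.
  have [j jS] := finset.set0Pn _ S0.
  have fjS : f j \in f @: S by apply: imset_f.
  move=> /(_ (lshift _ (enum_rank_in fjS (f j)))).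
  by rewrite col_mxEu !mxE => /eqP; rewrite oner_eq0.
rewrite -kermx_eq0 in nfree.
have /rowV0Pn[u /sub_kermxP uM u0] := nfree.
have [uf ug] : u *m class_incidence F f S = 0 /\ u *m class_incidence F g S = 0.
  by move: uM; rewrite mul_mx_row -row_mx0 => /eq_row_mx.
exists (\col_j \sum_(s | enum_val s == j) u 0 s); split.
- apply: contra_neq u0 => d0; apply/rowP => s; rewrite mxE.
  have := congr1 (fun w : 'cV_n => w (enum_val s) 0) d0; rewrite !mxE => <-.
  by rewrite (big_pred1 s) // => s' /=; rewrite (inj_eq enum_val_inj).
- move=> j jS; rewrite mxE big_pred0 // => s; apply/eqP => e.
  by case/negP: jS; rewrite -e enum_valP.
- by move=> i; under eq_bigr do rewrite mxE; apply: class_sum_extend0.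
- by move=> i; under eq_bigr do rewrite mxE; apply: class_sum_extend0.
Qed.

(** * Rounding along a kernel vector *)

Definition fractional (R : realType) (n : nat) (x : 'cV[R]_n) : {set 'I_n} :=
  [set j | x j 0 \isn't a Num.int]%SET.

(** A single fractional term cannot occur in an integral sum. *)
Lemma fractional_class_partner (R : realType) (n : nat) (I : finType)
    (h : 'I_n -> I) (x : 'cV[R]_n) :
  (forall i, \sum_(j | h j == i) x j 0 \is a Num.int) ->
  forall j, j \in fractional x ->
    exists k, [/\ k \in fractional x, k != j & h k = h j].
Proof.
move=> hx j; rewrite inE => /negP jx; apply: contrapT => nk; apply: jx.
have := hx (h j); rewrite (bigD1 j) //= => sumj.
rewrite -[x j 0](addrK (\sum_(i | (h i == h j) && (i != j)) x i 0)).
apply: rpredB => //; apply: rpred_sum => k /andP[/eqP hk kj].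
by apply/negPn/negP => kx; apply: nk; exists k; rewrite inE.
Qed.

(** Equivalent to y lying between the floor and the ceiling of x; this form
    makes transitivity and the preservation of integral bounds immediate. *)
Definition tightens (R : realType) (n : nat) (x y : 'cV[R]_n) : Prop :=
  forall j (z : int),
    (z%:~R <= x j 0 -> z%:~R <= y j 0) /\ (x j 0 <= z%:~R -> y j 0 <= z%:~R).

Lemma tightens_trans (R : realType) (n : nat) (x y z : 'cV[R]_n) :
  tightens x y -> tightens y z -> tightens x z.
Proof.
move=> xy yz j m; have [xy1 xy2] := xy j m; have [yz1 yz2] := yz j m.
by split=> [/xy1|/xy2].
Qed.

Lemma tightens_int (R : realType) (n : nat) (x y : 'cV[R]_n) j :
  tightens x y -> x j 0 \is a Num.int -> y j 0 = x j 0.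
Proof.
move=> xy /intrP[z xz]; have [lo up] := xy j z.
by apply/le_anti; rewrite xz lo ?up ?xz.
Qed.

(** The step length is the first time at which a moving coordinate hits the
    integer ahead of it; that coordinate stops being fractional, and no other
    one has left its unit interval. *)
Lemma push_to_integer (R : realType) (n : nat) (x d : 'cV[R]_n) :
  d != 0 -> (forall j, j \notin fractional x -> d j 0 = 0) ->
  exists t, [/\ 0 < t, tightens x (x + t *: d)
    & fractional (x + t *: d) \proper fractional x].
Proof.
move=> d0 dx.
have [j0 dj0] : exists j, d j 0 != 0.
  by apply/existsP; apply: contra_neqT d0 => /existsPn d0; apply/colP => j;
    rewrite mxE; apply/eqP/negPn/d0.
(* The time at which coordinate j reaches the next integer in direction d. *)
pose stop j : R := ((if 0 < d j 0 then Num.ceil (x j 0) else Num.floor (x j 0))%:~R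
                 - x j 0) / d j 0.
have frac j : d j 0 != 0 -> j \in fractional x.
  by move=> dj; apply/negPn; apply: contra_neqN dj => /dx.
have fl j : d j 0 != 0 -> (Num.floor (x j 0))%:~R < x j 0.
  move=> /frac; rewrite inE => xj.
  by rewrite lt_neqAle floor_le andbT -intrEfloor.
have ce j : d j 0 != 0 -> x j 0 < (Num.ceil (x j 0))%:~R.
  move=> /frac; rewrite inE => xj.
  by rewrite lt_neqAle ceil_ge andbT eq_sym -intrEceil.
case: (arg_minP stop (P := fun j => d j 0 != 0) dj0) => k dk kmin.
have t_gt0 : 0 < stop k.
  have := dk; rewrite /stop; case: (ltrgt0P (d k 0)) => // dk0 _.
    by rewrite divr_gt0 // subr_gt0 ce.
  by rewrite nmulr_rgt0 ?invr_lt0 // subr_lt0 fl.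
have tight : tightens x (x + stop k *: d).
  move=> j z; rewrite !mxE; have := kmin j.
  case: (ltrgt0P (d j 0)) => [dj|dj|->] kj; last by rewrite mulr0 addr0.
  - have {kj} : stop k * d j 0 <= (Num.ceil (x j 0))%:~R - x j 0.
      by rewrite -ler_pdivlMr //; apply: le_trans (kj isT) _; rewrite /stop dj.
    have tdj : 0 < stop k * d j 0 by rewrite mulr_gt0.
    move=> kj; split=> [zx|xz]; first by lra.
    have : (Num.ceil (x j 0))%:~R <= z%:~R :> R by rewrite ler_int ceil_le_int.
    by lra.
  - have {kj} : (Num.floor (x j 0))%:~R - x j 0 <= stop k * d j 0.
      rewrite -ler_ndivlMr //; apply: le_trans (kj isT) _.
      by rewrite /stop ltNge (ltW dj).
    have tdj : stop k * d j 0 < 0 by rewrite pmulr_rlt0.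
    move=> kj; split=> [zx|xz]; last by lra.
    have : z%:~R <= (Num.floor (x j 0))%:~R :> R by rewrite ler_int floor_ge_int.
    by lra.
exists (stop k); split => //; apply/properP; split.
  apply/fintype.subsetP => j; apply: contraLR; rewrite !inE !negbK => xj.
  by rewrite (tightens_int tight).
exists k; first exact: frac.
by rewrite inE negbK !mxE /stop divfK // addrC subrK intr_int.
Qed.

Lemma convex_between (R : realType) (M : lmodType R) (H : set M) (x d : M)
    (s t : R) :
  convex_set H -> 0 < s -> 0 < t -> H (x + s *: d) -> H (x + t *: - d) -> H x.
Proof.
move=> Hconv s0 t0 Hs Ht.
have st0 : 0 < s + t by rewrite addr_gt0.
have p0 : 0 <= t / (s + t) by rewrite divr_ge0 // ltW.
have p1 : t / (s + t) <= 1 by rewrite ler_pdivrMr // mul1r lerDr ltW.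
have := Hconv _ _ (Itv01 p0 p1) (mem_set Hs) (mem_set Ht).
rewrite inE; congr (H _).
rewrite /conv /= /unstable.onem !scalerDr !scalerA addrACA -!scalerDl addrC.
rewrite [_ + (1 - _)]addrC subrK scale1r scalerN -scalerBl.
rewrite (_ : _ - _ = 0) ?scale0r ?add0r //.
by field; rewrite gt_eqF.
Qed.

(** The rounding theorem for bipartite incidence matrices. It speaks of a
    convex set H that contains the roundings, and not of their convex hull,
    because the hypothesis then passes to the two points of the induction
    step by transitivity of [tightens]. *)
Lemma convex_rounding (R : realType) (n : nat) (I J : finType)
    (f : 'I_n -> I) (g : 'I_n -> J) (H : set 'cV[R]_n) (x : 'cV[R]_n) :
  convex_set H ->
  (forall i, \sum_(j | f j == i) x j 0 \is a Num.int) ->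
  (forall i, \sum_(j | g j == i) x j 0 \is a Num.int) ->
  (forall y : 'cV[R]_n, y \is a mxOver Num.int -> tightens x y ->
     (forall i, \sum_(j | f j == i) y j 0 = \sum_(j | f j == i) x j 0) ->
     (forall i, \sum_(j | g j == i) y j 0 = \sum_(j | g j == i) x j 0) ->
     H y) ->
  H x.
Proof.
move=> Hconv; have [N] := ubnP #|fractional x|.
elim: N => // N IH in x *; rewrite ltnS => xN xf xg Hx.
have [x0|S0] := eqVneq (fractional x) finset.set0.
  apply: Hx => //; apply/mxOverP => j k; rewrite (ord1 k).
  by apply/negPn; move/setP/(_ j): x0; rewrite !inE => ->.
have [d [d0 dS df dg]] := bipartite_kernel R S0
  (fractional_class_partner xf) (fractional_class_partner xg).
have step (e : 'cV[R]_n) : e != 0 ->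
    (forall j, j \notin fractional x -> e j 0 = 0) ->
    (forall i, \sum_(j | f j == i) e j 0 = 0) ->
    (forall i, \sum_(j | g j == i) e j 0 = 0) ->
    exists2 t, 0 < t & H (x + t *: e).
  move=> e0 eS ef eg; have [t [t0 xt lt_frac]] := push_to_integer e0 eS.
  have sumE (K : finType) (h : 'I_n -> K) :
      (forall i, \sum_(j | h j == i) e j 0 = 0) -> forall i,
      \sum_(j | h j == i) (x + t *: e) j 0 = \sum_(j | h j == i) x j 0.
    move=> eh i; under eq_bigr do rewrite !mxE.
    by rewrite big_split /= -mulr_sumr eh mulr0 addr0.
  exists t => //; apply: IH => [|i|i|y yint xy yf yg].
  - exact: leq_trans (proper_card lt_frac) xN.
  - by rewrite sumE.
  - by rewrite sumE.
  - apply: Hx => // [|i|i]; first exact: tightens_trans xt xy.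
    + by rewrite yf sumE.
    + by rewrite yg sumE.
have [s s0 Hs] := step d d0 dS df dg.
have [t t0 Ht] : exists2 t, 0 < t & H (x + t *: - d).
  apply: step => [|j jS|i|i]; first by rewrite oppr_eq0.
  - by rewrite mxE dS ?oppr0.
  - by under eq_bigr do rewrite mxE; rewrite sumrN df oppr0.
  - by under eq_bigr do rewrite mxE; rewrite sumrN dg oppr0.
exact: convex_between Hconv s0 t0 Hs Ht.
Qed.

(** * The indicator rows and the resulting hulls *)

(** The value None of tau stands for the summand 0; it gets no row. *)
Definition class_indicators (I J : finType) (n : nat) (beta : 'I_n -> I)
    (tau : 'I_n -> option J) : 'M[int]_(#|I| + #|J|, n) :=
  col_mx (\matrix_(i < #|I|, j < n) (beta j == enum_val i)%:R)
         (\matrix_(i < #|J|, j < n) (tau j == Some (enum_val i))%:R).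

Lemma indicator_mulmx (R : realType) (k n : nat) (P : 'I_k -> pred 'I_n)
    (x : 'cV[R]_n) i :
  (int_mx R (\matrix_(i, j) (P i j)%:R) *m x) i 0 = \sum_(j | P i j) x j 0.
Proof.
rewrite mxE [RHS]big_mkcond; apply: eq_bigr => j _; rewrite !mxE.
by case: (P i j); rewrite ?mul1r ?mul0r.
Qed.

(** The class of None has no row in the indicator matrix. Its sum is the total
    minus the sums of the other tau-classes, and the total is the sum over all
    beta-classes, so it is integral as well. *)
Lemma class_indicators_int (R : realType) (I J : finType) (n : nat)
    (beta : 'I_n -> I) (tau : 'I_n -> option J) (x : 'cV[R]_n) :
  int_mx R (class_indicators beta tau) *m x \is a mxOver Num.int ->
  (forall i, \sum_(j | beta j == i) x j 0 \is a Num.int) /\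
  (forall t, \sum_(j | tau j == t) x j 0 \is a Num.int).
Proof.
rewrite /int_mx map_col_mx mul_col_mx => /mxOverP Wx.
have betaP i : \sum_(j | beta j == i) x j 0 \is a Num.int.
  have := Wx (lshift _ (enum_rank i)) 0.
  by rewrite col_mxEu indicator_mulmx enum_rankK.
have tauP t : \sum_(j | tau j == Some t) x j 0 \is a Num.int.
  have := Wx (rshift _ (enum_rank t)) 0.
  by rewrite col_mxEd indicator_mulmx enum_rankK.
split=> // -[t|] //.
have : \sum_j x j 0 \is a Num.int.
  by rewrite (partition_big beta xpredT) //=; apply: rpred_sum => i _.
rewrite (partition_big tau xpredT) //= (bigD1 None) //= => tot.
rewrite -[X in X \is a _](addrK (\sum_(t | t != None) \sum_(j | tau j == t) x j 0)).
by apply: rpredB => //; apply: rpred_sum => -[t|].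
Qed.

(** This forces the column selection of a submatrix with all n columns to be
    trivial. A strictly increasing map of 'I_n is a bijection, so it sends the
    sorted enumeration to a sorted enumeration of the same elements. *)
Lemma strictly_increasing_ord_id (n : nat) (g : 'I_n -> 'I_n) :
  {homo g : i j / (i < j)%N} -> g =1 id.
Proof.
move=> gmono.
have ginj : injective g.
  move=> i j gij; apply/val_inj; case: (ltngtP i j) => // /gmono.
    by rewrite gij ltnn.
  by rewrite gij ltnn.
have srt : sorted (fun i j : 'I_n => (i < j)%N) (enum 'I_n).
  by rewrite -[sorted _ _]/(sorted (relpre val ltn) _) -sorted_map val_enum_ord iota_ltn_sorted.
have : [seq g i | i <- enum 'I_n] = [seq i | i <- enum 'I_n].
  rewrite map_id; apply: (irr_sorted_eq _ _ _ srt).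
  - by move=> j i k; apply: ltn_trans.
  - by move=> i; apply: ltnn.
  - by apply: (homo_sorted gmono).
  - move=> i; rewrite mem_enum; apply/mapP.
    by exists (invF ginj i); rewrite ?mem_enum // f_invF.
by move/eq_in_map => gid i; apply: gid; rewrite mem_enum.
Qed.

Lemma class_sums_determine_mulmx (R : realType) (l n : nat)
    (C : 'M[int]_(l, n)) (I J : finType) (beta : 'I_n -> I) (tau : 'I_n -> J)
    (u : I -> 'cV[int]_l) (v : J -> 'cV[int]_l) (x y : 'cV[R]_n) :
  (forall j, col j C = u (beta j) + v (tau j)) ->
  (forall i, \sum_(j | beta j == i) y j 0 = \sum_(j | beta j == i) x j 0) ->
  (forall i, \sum_(j | tau j == i) y j 0 = \sum_(j | tau j == i) x j 0) ->
  int_mx R C *m y = int_mx R C *m x.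
Proof.
move=> colC ybeta ytau.
have CE (z : 'cV[R]_n) r : (int_mx R C *m z) r 0 =
    \sum_i (u i r 0)%:~R * (\sum_(j | beta j == i) z j 0) +
    \sum_i (v i r 0)%:~R * (\sum_(j | tau j == i) z j 0).
  transitivity (\sum_j ((u (beta j) r 0)%:~R * z j 0
                        + (v (tau j) r 0)%:~R * z j 0)).
    rewrite mxE; apply: eq_bigr => j _; rewrite mxE -mulrDl -intrD.
    by have := congr1 (fun w : 'cV_l => w r 0) (colC j); rewrite !mxE => ->.
  rewrite big_split /=; congr (_ + _).
    rewrite (partition_big beta xpredT) //; apply: eq_bigr => i _ /=.
    by rewrite mulr_sumr; apply: eq_bigr => j /eqP ->.
  rewrite (partition_big tau xpredT) //; apply: eq_bigr => i _ /=.
  by rewrite mulr_sumr; apply: eq_bigr => j /eqP ->.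
apply/colP => r; rewrite !CE.
by congr (_ + _); apply: eq_bigr => i _; rewrite ?ybeta ?ytau.
Qed.

(** An integral bound on one coordinate passes from x to y because y tightens
    x; the rows from C and - C take the same value at x and y. *)
Lemma tightens_polyhedron (R : realType) (l m n : nat) (C : 'M[int]_(l, n))
    (A : 'M[int]_(m, n)) (b : 'cV[int]_m) (x y : 'cV[R]_n) :
  submatrix A (signed_stack C) ->
  tightens x y -> int_mx R C *m y = int_mx R C *m x ->
  polyhedron R A b x -> polyhedron R A b y.
Proof.
move=> [f [g [_ /strictly_increasing_ord_id gid ->]]] xy Cxy Px i.
have rowE (z : 'cV[R]_n) : (int_mx R (mxsub f g (signed_stack C)) *m z) i 0 =
    (col_mx (col_mx z (- z)) (col_mx (int_mx R C *m z) (- (int_mx R C *m z))))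
      (f i) 0.
  transitivity ((int_mx R (signed_stack C) *m z) (f i) 0).
    by rewrite !mxE; apply: eq_bigr => j _; rewrite !mxE gid.
  rewrite /int_mx /signed_stack !map_col_mx !mul_col_mx !map_mxN map_mx1.
  by rewrite mulNmx mul1mx mulNmx.
move: (Px i); rewrite !rowE.
case: (fintype.split_ordP (f i)) => k ->; last first.
  by rewrite !col_mxEd Cxy.
rewrite !col_mxEu; case: (fintype.split_ordP k) => j ->.
  by rewrite !col_mxEu mxE; apply xy.
rewrite !col_mxEd !mxE !(lerNl _ (_%:~R)) -!mulrNz.
by apply xy.
Qed.

Lemma convex_convex_hull (R : numDomainType) (M : lmodType R) (X : set M) :
  convex_set (convex_hull X).
Proof.
move=> x y p; rewrite !inE => Hx Hy K KX.
have := KX.1 x y p (mem_set (Hx K KX)) (mem_set (Hy K KX)).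
by rewrite inE.
Qed.

(** The integer points satisfy W x integral trivially; the other inclusion
    rounds a mixed-integer point within its fiber of W. *)
Lemma class_indicators_hull (R : realType) (l m n : nat) (C : 'M[int]_(l, n))
    (A : 'M[int]_(m, n)) (b : 'cV[int]_m) (I J : finType)
    (beta : 'I_n -> I) (tau : 'I_n -> option J)
    (u : I -> 'cV[int]_l) (v : option J -> 'cV[int]_l) :
  submatrix A (signed_stack C) ->
  (forall j, col j C = u (beta j) + v (tau j)) ->
  mixed_integer_hull R (class_indicators beta tau) A b = integer_hull R A b.
Proof.
move=> subA colC; apply/seteqP; split.
- apply: smallest_sub; first exact: convex_convex_hull.
  move=> x [Px /class_indicators_int[xbeta xtau]].
  apply: (convex_rounding _ xbeta xtau); first exact: convex_convex_hull.
  move=> y yint xy ybeta ytau; apply: sub_gen_smallest; split=> //.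
  apply: (tightens_polyhedron subA xy _ Px).
  exact: class_sums_determine_mulmx colC ybeta ytau.
- apply: smallest_sub; first exact: convex_convex_hull.
  move=> x [Px xint]; apply: sub_gen_smallest; split=> //.
  apply: mxOverM => //; apply/mxOverP => i j; rewrite mxE; exact: intr_int.
Qed.

Lemma mem_finite_index (T : choiceType) (X : set T) :
  finite_set X -> forall x, X x -> {i : (fset_set X : Type) | val i = x}.
Proof.
move=> finX x Xx; have xX : x \in fset_set X by rewrite in_fset_set // mem_set.
by exists (FSetSub xX).
Qed.

Unset Implicit Arguments.

(* Cardinalities are taken in \bar R, so B and T may be infinite. *)
Theorem theorem2 (R : realType) (l m n : nat) (C : 'M[int]_(l, n))
    (A : 'M[int]_(m, n)) (B T : set 'cV[int]_l) :
  \rank (int_mx R A) = n ->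
  submatrix A (signed_stack C) ->
  range (fun j : 'I_n => col j C) `<=` minkowski_sum B (T `|` [set 0]) ->
  forall b : 'cV[int]_m,
    ((integrality_number R A b)%:R%:E <= counting B + counting T :> \bar R)%E.
Proof.
move=> _ subA colsC b; rewrite /counting.
(* An infinite B or T makes the right-hand side +oo. *)
case: asboolP => finB; last by rewrite addye ?leey //; case: ifP.
case: asboolP => finT; last by rewrite addey ?leey.
pose u (i : fset_set B) : 'cV[int]_l := val i.
pose v (t : option (fset_set T)) : 'cV[int]_l := if t is Some i then val i else 0.
have decomp j : {bt : fset_set B * option (fset_set T) |
    col j C = u bt.1 + v bt.2}.
  apply: cid.
  have [|w Bw [z Tz wz]] := colsC (col j C); first by exists j.
  have [i ui] := mem_finite_index finB Bw.
  case: Tz => [/(mem_finite_index finT)[t vt]|z0].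
    by exists (i, Some t); rewrite /u /v /= ui vt.
  by exists (i, None); rewrite /u /v /= ui -wz z0.
rewrite -EFinD lee_fin -natrD ler_nat /integrality_number.
case: ex_minnP => k _; apply; apply/asboolP.
rewrite !cardfE.
exists (class_indicators (fun j => (sval (decomp j)).1)
                         (fun j => (sval (decomp j)).2)).
exact: (class_indicators_hull R b subA (fun j => svalP (decomp j))).
Qed.
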